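(* Let $K$ be a nontrivial finitely generated group equipped with the left-invariant Cayley metric of a fixed finite generating set, and suppose $K$ satisfies property $P_{10}'(192)$. Then $K$ is non-amenable.
   Context: For a group $K$ with a fixed finite generating set, $|g|$ denotes the word length of $g$ (distance to $1$ in the left-invariant Cayley metric). A finite sequence is called $n$-aperiodic ($n\ge 1$) if it does not contain $n+1$ consecutive (adjacent) identical nonempty blocks. Property $P_n'(r)$ (for a positive integer $n$ and real $r>0$; $K$ a nontrivial finitely generated group with fixed Cayley metric): there exists $\xi\in K$ such that for every $k\ge 1$, every $n$-aperiodic sequence $x_1,\dots,x_k$ of elements of $K$ with $x_i\neq 1$ and $|x_i|\le r$ for all $i$, and all $\epsilon_1,\dots,\epsilon_k\in\{+1,-1\}$, one has $$|\xi^{\epsilon_1}x_1\xi^{\epsilon_2}x_2\cdots\xi^{\epsilon_k}x_k|>r.$$ A finitely generated group $\Gamma$ is amenable if for every $\epsilon>0$ and all finite subsets $K,S\subseteq\Gamma$ there is a finite subset $F\subseteq\Gamma$ with $S\subseteq F$ and $\frac{|FK\setminus F|}{|F|}<\epsilon$. *)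

(* Defs.v *)
From HB Require Import structures.
From mathcomp Require Import all_boot all_order all_algebra.
From mathcomp Require Import finmap reals.

Set Implicit Arguments.
Unset Strict Implicit.
Unset Printing Implicit Defensive.

Import Order.TTheory GRing.Theory Num.Theory.

Local Open Scope fset_scope.
Local Open Scope ring_scope.

Section CayleyMetric.
Variables (K : groupType) (S : {fset K}).

Definition letters : {fset K} := S `|` [fset s^-1%g | s in S].

Definition is_word_of_length (k : nat) (g : K) : bool :=
  [exists w : k.-tuple letters, (\prod_(s <- w) val s)%g == g].

Definition generates : Prop := forall g : K, exists k, is_word_of_length k g.

(* The distance from 1 to g in the Cayley graph of K with respect to S. *)
Definition word_length (genS : generates) (g : K) : nat := ex_minn (genS g).

End CayleyMetric.

Definition aperiodic (T : eqType) (n : nat) (s : seq T) : Prop :=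
  forall b : seq T, b != [::] -> ~~ infix (flatten (nseq n.+1 b)) s.

(* The sign e = true stands for -1 and e = false for +1. *)
Definition signed_power (K : groupType) (x : K) (e : bool) : K :=
  if e then x^-1%g else x.

Definition property_P' (R : realType) (K : groupType) (S : {fset K})
    (genS : generates S) (n : nat) (r : R) : Prop :=
  exists xi : K,
    forall (k : nat) (x : k.-tuple K) (e : k.-tuple bool),
      (1 <= k)%N ->
      aperiodic n x ->
      (forall i, tnth x i != 1%g) ->
      (forall i, (word_length genS (tnth x i))%:R <= r) ->
      (word_length genS
         (\prod_(i < k) (signed_power xi (tnth e i) * tnth x i))%g)%:R > r.

(* F != fset0 makes the quotient meaningful: in MathComp 0 / 0 = 0. *)
Definition amenable (R : realType) (G : groupType) : Prop :=
  forall (eps : R) (A B : {fset G}), 0 < eps ->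
    exists F : {fset G},
      [/\ F != fset0, B `<=` F &
          #|` [fset (f * a)%g | f in F, a in A] `\` F|%:R / #|` F|%:R < eps].

(* Main.v *)
Require Import Defs.
From mathcomp Require Import all_boot all_order all_algebra.
From mathcomp Require Import finmap reals.
From mathcomp Require Import zify.

(** In an amenable group, every element [xi] satisfies a relation
    [xi^{e_1} x_1 ... xi^{e_k} x_k = 1] whose coefficients [x_i] are nontrivial,
    bounded in length and form a squarefree sequence, that is, one without two
    adjacent equal blocks ([amenable_relation]). Since a squarefree sequence is
    10-aperiodic and the identity has length 0, such a relation with coefficients
    of length at most 192 contradicts the property.

    To find the relation, take sixteen or more distinct elements [A] of length at
    most 48 and a finite set [F] that is almost invariant under right
    multiplication by [A] and by [xi]. Choose in the interior of [F] a maximal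
    set of points [x] with disjoint translates [x A], and assign every interior
    point [g] to a chosen point whose translate meets [g A]. This cuts the interior
    into cells; two points of a cell differ by an element of length at most
    4 * 48 = 192, and there are at most [#F / 16] cells. Join the cells by an
    edge for every pair of interior points [g], [g xi]; almost every point of [F]
    gives one. As the edges greatly outnumber the cells, deleting cells of low
    degree leaves a nonempty core in which every cell still has degree at least 9
    ([dense_core]).

    Now walk in the core: from the current point [u] step to another point [v] of
    its cell, at the cost of a letter [x = v^-1 u], and cross from [v] along [xi]
    or [xi^-1] to a point of the core. Undirected edges are what makes the core
    exist, and they are the reason for the signs [e_i]. At every moment at least
    four distinct letters are available, so however the walk went before, it can
    be continued for any length with a squarefree sequence of letters
    ([squarefree_walk_exists]): the number of such walks at least doubles with
    each step. The core is finite, so a long walk returns to a point, and the part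
    of it between two visits spells the relation. *)

Set Implicit Arguments.
Unset Strict Implicit.
Unset Printing Implicit Defensive.

Import Order.TTheory GRing.Theory Num.Theory.

(** * Squarefree walks *)

Lemma count_has_le (A B : Type) (P : B -> pred A) (s : seq A) (r : seq B) :
  count (fun x => has (P^~ x) r) s <= \sum_(b <- r) count (P b) s.
Proof.
elim: r => [|b r IHr].
  by rewrite big_nil (@eq_count _ _ pred0) // count_pred0.
rewrite big_cons (@eq_count _ _ (predU (P b) (fun x => has (P^~ x) r))) //.
apply: (leq_trans _ (leq_add (leqnn _) IHr)).
by rewrite -count_predUI leq_addr.
Qed.

Section Squarefree.
Variable T : eqType.
Implicit Types (s b v w : seq T) (x : T).

(** For [0 < p <= size s] the equality forces [2 * p <= size s], because the
    two blocks must have the same size. *)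
Definition starts_with_square (s : seq T) (p : nat) :=
  take p s == take p (drop p s).

(** Built by prepending, so that only squares at the front of the word need to
    be tested: all others were tested at an earlier letter. *)
Fixpoint squarefree (s : seq T) : bool :=
  if s is _ :: s' then
    squarefree s' && ~~ has (starts_with_square s) (iota 1 (size s))
  else true.

Lemma squarefree_drop n s : squarefree s -> squarefree (drop n s).
Proof. by elim: s n => [|x s IHs] [|n] //= /andP[/IHs]. Qed.

Lemma squarefree_aperiodic n s : 0 < n -> squarefree s -> aperiodic n s.
Proof.
case: n => // n _ sf_s b; case: b => // x b _.
apply/negP => /infixP[u [t def_s]].
have := squarefree_drop (size u) sf_s.
have -> : drop (size u) s = x :: b ++ x :: b ++ (flatten (nseq n (x :: b)) ++ t).
  by rewrite def_s drop_size_cat //= -!catA /= -!catA.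
move: (_ ++ t) => t' /andP[_ /hasPn no_sq].
have /no_sq/negP[] : (size b).+1 \in iota 1 (size (x :: b ++ x :: b ++ t')).
  by rewrite mem_iota /= size_cat; lia.
rewrite /starts_with_square -cat_cons drop_size_cat // take_size_cat //.
by rewrite -cat_cons take_size_cat.
Qed.

Lemma aperiodic_infix n s1 s2 : infix s1 s2 -> aperiodic n s2 -> aperiodic n s1.
Proof. by move=> s12 ap b /ap; apply: contra => /infix_trans; apply. Qed.

Variable next : seq T -> seq T.

(** Words grow at the front: the newest letter is the head, and the letters
    allowed next depend on the whole word written so far. *)
Fixpoint is_walk w := if w is x :: v then (x \in next v) && is_walk v else true.

Lemma is_walk_drop n w : is_walk w -> is_walk (drop n w).
Proof. by elim: w n => [|x w IHw] [|n] //= /andP[_ /IHw]. Qed.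

Definition extensions (ws : seq (seq T)) := [seq x :: v | v <- ws, x <- next v].

Fixpoint squarefree_walks n : seq (seq T) :=
  if n is m.+1 then
    [seq w <- extensions (squarefree_walks m) | squarefree w]
  else [:: [::]].

Lemma squarefree_walksP n w : w \in squarefree_walks n ->
  [/\ size w = n, is_walk w & squarefree w].
Proof.
elim: n w => [|n IHn] w /=; first by rewrite inE => /eqP->.
rewrite mem_filter => /andP[sf_w /allpairsPdep[v [x [v_in x_in def_w]]]].
have [sz_v walk_v _] := IHn _ v_in.
by split; rewrite // def_w /= ?sz_v ?x_in.
Qed.

Lemma squarefree_walks_drop n w i : w \in squarefree_walks n ->
  drop i w \in squarefree_walks (n - i).
Proof.
elim: n w i => [|n IHn] w [|i]; rewrite ?drop0 //=.
  by rewrite inE => /eqP->.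
by rewrite mem_filter => /andP[_ /allpairsPdep[v [x [v_in _ ->]]]]; apply: IHn.
Qed.

Hypothesis next_uniq : forall v, is_walk v -> uniq (next v).
Hypothesis next_size : forall v, is_walk v -> 4 <= size (next v).

Lemma extensions_uniq n :
  uniq (squarefree_walks n) -> uniq (extensions (squarefree_walks n)).
Proof.
move=> Us; apply: allpairs_uniq_dep => //.
  by move=> v /squarefree_walksP[_ + _]; apply: next_uniq.
by case=> v x [v' x'] _ _ [-> /= ->].
Qed.

Lemma squarefree_walks_uniq n : uniq (squarefree_walks n).
Proof. by elim: n => // n IHn; apply/filter_uniq/extensions_uniq. Qed.

(** A word that starts with a square of a block of length [p] is determined by
    what remains after deleting the first copy of the block, since the second
    copy is still there. The remainder is a suffix of a squarefree walk, hence
    itself a squarefree walk, shorter by [p] letters. *)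
Lemma count_starts_with_square n p : 0 < p ->
  count (starts_with_square^~ p) (extensions (squarefree_walks n))
    <= size (squarefree_walks (n.+1 - p)).
Proof.
case: p => // p _; rewrite subSS -size_filter.
rewrite -(size_map (drop p.+1)); apply: uniq_leq_size.
  rewrite map_inj_in_uniq.
    exact/filter_uniq/extensions_uniq/squarefree_walks_uniq.
  move=> w w'; rewrite !mem_filter => /andP[/eqP sq_w _] /andP[/eqP sq_w' _].
  by move=> eq_d; rewrite -(cat_take_drop p.+1 w) sq_w eq_d -sq_w' cat_take_drop.
move=> u /mapP[w]; rewrite mem_filter.
move=> /andP[_ /allpairsPdep[v [x [v_in _ ->]]]] ->.
exact: squarefree_walks_drop.
Qed.

Lemma size_extensions n :
  4 * size (squarefree_walks n) <= size (extensions (squarefree_walks n)).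
Proof.
rewrite size_allpairs_dep.
have : {in squarefree_walks n, forall v, 4 <= size (next v)}.
  by move=> v /squarefree_walksP[_ + _]; apply: next_size.
elim: (squarefree_walks n) => //= v s IHs le4.
rewrite mulnS leq_add ?le4 ?mem_head // IHs // => u u_s.
by rewrite le4 // inE u_s orbT.
Qed.

(** Rosenfeld's counting argument. With [a n] squarefree walks of length [n],
    at least [4 * a n] words extend them by one letter, and at most
    [a n + a n.-1 + ... + a 0] of these contain a square, one summand for each
    length of the repeated block. If [a] has at least doubled at every earlier
    step, this sum is below [2 * a n], so at least [2 * a n] extensions
    survive and [a] doubles once more. *)
Lemma squarefree_walks_double n :
  2 * size (squarefree_walks n) <= size (squarefree_walks n.+1)
  /\ \sum_(0 <= i < n.+1) size (squarefree_walks i)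
       <= 2 * size (squarefree_walks n).
Proof.
have grow m : \sum_(0 <= i < m.+1) size (squarefree_walks i)
       <= 2 * size (squarefree_walks m) ->
    2 * size (squarefree_walks m) <= size (squarefree_walks m.+1).
  move=> le_sum; set e := extensions (squarefree_walks m).
  have bad : count (predC squarefree) e
      <= \sum_(0 <= i < m.+1) size (squarefree_walks i).
    rewrite (@eq_in_count _ _ (fun w => has (starts_with_square w) (iota 1 m.+1))).
      apply: leq_trans (count_has_le (fun p w => starts_with_square w p) _ _) _.
      rewrite big_nat_rev /= add0n.
      rewrite [leqLHS](_ : _ =
        \sum_(1 <= i < m.+2) count (starts_with_square^~ i) e); last first.
        by rewrite /index_iota subSS subn0.
      rewrite big_add1 /= !big_nat; apply: leq_sum => i /andP[_ lt_im].
      by apply: leq_trans (count_starts_with_square _ _) _; rewrite ?subSS.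
    move=> w /allpairsPdep[v [x [v_in _ ->]]].
    have [<- _ sf_v] := squarefree_walksP v_in.
    rewrite -[LHS]/(~~ (squarefree v && ~~ has _ (iota 1 (size v).+1))).
    by rewrite sf_v negbK.
  have := count_predC squarefree e; rewrite -size_filter.
  have := size_extensions m; rewrite -/e.
  rewrite [size (squarefree_walks m.+1)]/= -/e; lia.
elim: n => [|n [IH1 IH2]].
  have le_sum0 : \sum_(0 <= i < 1) size (squarefree_walks i)
      <= 2 * size (squarefree_walks 0) by rewrite big_nat1.
  by split=> //; apply: grow.
have le_sum : \sum_(0 <= i < n.+2) size (squarefree_walks i)
    <= 2 * size (squarefree_walks n.+1).
  by rewrite big_nat_recr //=; move: IH1 IH2 => /=; lia.
by split=> //; apply: grow.
Qed.

Theorem squarefree_walk_exists n :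
  exists w, [/\ size w = n, is_walk w & squarefree w].
Proof.
have : 0 < size (squarefree_walks n).
  elim: n => // n IHn.
  by apply: leq_trans (squarefree_walks_double n).1; rewrite muln_gt0.
case def_s : (squarefree_walks n) => [//|w s] _.
by exists w; apply: squarefree_walksP; rewrite def_s mem_head.
Qed.

End Squarefree.

Lemma is_walk_mem (T : eqType) (next : seq T -> seq T) w x :
  is_walk next w -> x \in w -> exists2 v, is_walk next v & x \in next v.
Proof.
elim: w => //= y w IHw /andP[y_next walk_w]; rewrite inE.
by move=> /predU1P[->|/(IHw walk_w)//]; exists w.
Qed.

(** * Dense cores, maximal packings and Folner sets *)

(** [E] is the edge set of a multigraph on [V], with loops and multiple edges
    allowed. Deleting a vertex of degree at most [D] keeps the inequality
    [D * #vertices < #edges], so repeated deletion cannot exhaust the graph;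
    it stops at an induced subgraph all of whose degrees exceed [D]. *)
Lemma dense_core (A I : eqType) (src tgt : A -> I) (D : nat)
    (E : seq A) (V : seq I) :
  {in E, forall e, (src e \in V) && (tgt e \in V)} ->
  D * size V < size E ->
  exists J : seq I, J != [::] /\ {in J, forall i,
    D < count (fun e => [&& src e \in J, tgt e \in J &
                            (src e == i) || (tgt e == i)]) E}.
Proof.
move: {2}(size V) (leqnn (size V)) => n.
elim: n E V => [|n IHn] E V.
  rewrite leqn0 size_eq0 => /eqP->; case: E => [|e E] //= /(_ e).
  by rewrite mem_head => /(_ isT).
move=> le_V EV dense.
pose inc i e := (src e == i) || (tgt e == i).
have [sparse|/hasPn full] := boolP (has (fun i => count (inc i) E <= D) V).
  have [i iV le_iD] := hasP sparse.
  pose E' := [seq e <- E | ~~ inc i e].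
  pose V' := [seq j <- V | j != i].
  have lt_V' : size V' < size V.
    rewrite size_filter -(count_predC (pred1 i) V) -add1n leq_add2r.
    by rewrite -has_count has_pred1.
  have [||/=|J [J0 HJ]] := IHn E' V'.
  - by rewrite -ltnS; apply: leq_trans lt_V' _.
  - move=> e; rewrite !mem_filter negb_or.
    by move=> /andP[/andP[-> ->] /EV].
  - move: dense; rewrite [size E']size_filter -(count_predC (inc i) E).
    have : D * (size V').+1 <= D * size V by rewrite leq_mul2l lt_V' orbT.
    have -> : count (predC (inc i)) E = count (fun e => ~~ inc i e) E by [].
    by rewrite mulnS; lia.
  exists J; split=> // j jJ; apply: leq_trans (HJ j jJ) _.
  by rewrite count_filter; apply: sub_count => e /= /andP[].
exists V; split.
  case: V EV dense {le_V full} => //; case: E => [|e E] EV.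
    by rewrite muln0.
  by have := EV e; rewrite mem_head => /(_ isT).
move=> i iV; have := full i iV; rewrite -ltnNge.
move=> lt; apply: leq_trans lt _; rewrite leq_eqVlt; apply/orP; left; apply/eqP.
by apply: eq_in_count => e /EV /andP[-> ->].
Qed.

Lemma maximal_independent (T : eqType) (r : rel T) (s : seq T) :
  uniq s -> reflexive r ->
  exists N : seq T, [/\ uniq N, {subset N <= s},
    pairwise (fun x y => ~~ r x y) N & {in s, forall x, has (r x) N}].
Proof.
move=> + rr; elim: s => [|x s IHs] /=; first by exists [::].
case/andP => xs /IHs[N [uN sN pN hN]].
have [hx|hx] := boolP (has (r x) N).
  exists N; split=> //; first by move=> y /sN; rewrite inE => ->; rewrite orbT.
  by move=> y; rewrite inE => /predU1P[->|/hN].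
exists (x :: N); split.
- by rewrite /= uN andbT; apply: contra xs => /sN.
- by move=> y; rewrite !inE => /predU1P[->|/sN ->]; rewrite ?eqxx ?orbT.
- by rewrite /= pN all_predC hx.
- by move=> y; rewrite inE /= => /predU1P[->|/hN->]; rewrite ?rr ?orbT.
Qed.

(** Each [a] in [A] sends the points that leave [F] under it injectively into
    [F A \ F], so at most [size A] times as many points fail to be interior as
    there are points in [F A \ F]. *)
Lemma folner_interior (R : realType) (G : groupType) (A : seq G) (m : nat) :
  amenable R G -> exists F : seq G,
    uniq F /\ (m * count (fun g => has (fun a => (g * a)%g \notin F) A) F < size F)%N.
Proof.
move=> amG.
pose Af : {fset G} := [fset a in A]%fset.
pose eps : R := ((m * size A).+1%:R^-1)%R.
have eps_gt0 : (0 < eps)%R by rewrite invr_gt0 ltr0Sn.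
have [F [F0 _ small]] := amG eps Af fset0 eps_gt0.
exists (enum_fset F); split; first exact: fset_uniq.
set FA := (_ `\` F)%fset in small.
have card_gt0 : (0 < #|` F|)%N by rewrite cardfs_gt0.
have lt_FA : (#|` FA| * (m * size A).+1 < #|` F|)%N.
  move: small; rewrite ltr_pdivrMr ?ltr0n // /eps mulrC.
  by rewrite ltr_pdivlMr ?ltr0Sn // -natrM ltr_nat.
suff le_FA : (count (fun g => has (fun a => (g * a)%g \notin F) A) F <= size A * #|` FA|)%N.
  apply: leq_ltn_trans lt_FA; apply: leq_trans (leq_mul (leqnn m) le_FA) _.
  by rewrite mulnA mulnC leq_mul2l leqnSn orbT.
apply: leq_trans (count_has_le (fun a g => (g * a)%g \notin F) _ _) _.
rewrite -sum1_size big_distrl /= big_seq [leqRHS]big_seq.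
apply: leq_sum => a aA; rewrite mul1n -size_filter -(size_map (fun g => g * a)%g).
apply: uniq_leq_size.
  by rewrite map_inj_uniq ?filter_uniq ?fset_uniq //; apply: mulIg.
move=> h /mapP[g]; rewrite mem_filter => /andP[gaF gF] ->.
rewrite in_fsetD gaF /=; apply/imfset2P; exists g => //.
by exists a => //; rewrite inE.
Qed.

(** * Walks between cells *)

Section CellWalk.
Local Open Scope group_scope.
Variables (G : groupType) (xi start : G) (W : pred G).

(** The point reached by a walk. Reading a letter [x] at a point [u] means moving
    to [v = u x^-1] and then crossing from [v] to [v xi], or to [v xi^-1] if
    [v xi] lies outside [W]. Dividing by [x] makes the word, whose newest letter
    comes first, spell the way back to the starting point from left to right. *)
Fixpoint position (w : seq G) : G :=
  if w is x :: w' then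
    let v := position w' * x^-1 in if W (v * xi) then v * xi else v * xi^-1
  else start.

Lemma position_prod y w : exists2 e : seq bool, size e = size y &
  position (y ++ w) *
    \prod_(i < size y) (signed_power xi (nth false e i) * nth 1 y i)
  = position w.
Proof.
elim: y => [|x y [e sz_e IHy]].
  by exists [::]; rewrite // big_ord0 mulg1.
exists (W (position (y ++ w) * x^-1 * xi) :: e); rewrite /= ?sz_e //.
rewrite big_ord_recl /= -[RHS]IHy !mulgA; congr (_ * _).
by case: ifP => _ /=; rewrite ?mulgK ?mulgVK.
Qed.

Variables (cell : G -> G) (P : seq G).

(** From [u] the walk may pass to [v] in the same cell if one of the two
    crossings at [v] leads back into [W]. *)
Definition exits (u v : G) : bool :=
  (cell v == cell u) && (W (v * xi) || W (v * xi^-1)).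

(** [v = u] is left out because its letter would be the identity. *)
Definition moves (w : seq G) : seq G :=
  let u := position w in
  [seq v^-1 * u | v <- P & (v != u) && exits u v].

Hypothesis W_start : W start.

Lemma moves_position w v : position w * (v^-1 * position w)^-1 = v.
Proof. by rewrite invgM invgK mulVKg. Qed.

Lemma position_in w : is_walk moves w -> W (position w).
Proof.
case: w => //= x w /andP[/mapP[v]].
rewrite mem_filter => /andP[/andP[_ /andP[_ exit_v]] _] -> _.
by rewrite moves_position; case: ifP exit_v => //= ->.
Qed.

Lemma moves_uniq w : uniq P -> uniq (moves w).
Proof.
move=> uP; rewrite map_inj_uniq ?filter_uniq // => v v' /mulIg.
exact: invg_inj.
Qed.

(** One exit may be lost, the one through the current point itself. *)
Lemma size_moves w : uniq P ->
  (count (exits (position w)) P <= (size (moves w)).+1)%N.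
Proof.
move=> uP; set u := position w.
rewrite size_map size_filter -add1n.
apply: (@leq_trans (count_mem u P + count (fun v => (v != u) && exits u v) P)).
  rewrite -count_predUI; apply: leq_trans (leq_addr _ _); apply: sub_count.
  by move=> v /= ->; rewrite andbT orbN.
by rewrite leq_add2r count_uniq_mem //; case: (u \in P).
Qed.

Lemma moves_mem w x : is_walk moves w -> x \in moves w ->
  x != 1 /\ exists u v, [/\ u \in W, v \in P, cell v = cell u & x = v^-1 * u].
Proof.
move=> /position_in Wu /mapP[v].
rewrite mem_filter => /andP[/andP[ne /andP[/eqP eq_c _]] vP] ->; split.
  by rewrite mulg_eq1 eqg_inv.
by exists (position w), v.
Qed.

(** A walk longer than the number of points of [W] visits some point twice, and
    the piece of the walk between the two visits spells a relation. *)
Lemma squarefree_relation (F : seq G) n : 0 < n -> uniq P -> {subset W <= F} ->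
  (forall u, W u -> 5 <= count (exits u) P)%N ->
  exists (x : seq G) (e : seq bool),
    [/\ x != [::], size e = size x, aperiodic n x,
      {in x, forall y, y != 1 /\
        exists u v, [/\ u \in W, v \in P, cell v = cell u & y = v^-1 * u]} &
      \prod_(i < size x) (signed_power xi (nth false e i) * nth 1 x i) = 1].
Proof.
move=> n_gt0 uP WF deg.
have [w [sz_w walk_w sf_w]] : exists w : seq G,
    [/\ size w = size F, is_walk moves w & squarefree w].
  apply: squarefree_walk_exists => v walk_v; first exact: moves_uniq.
  by rewrite -ltnS; apply: leq_trans (size_moves _ _) => //; apply/deg/position_in.
pose visited := [seq position (drop i w) | i <- iota 0 (size F).+1].
have /(uniqPn 1)[i [j [lt_ij]]] : ~~ uniq visited.
  apply/negP => /uniq_leq_size le_visited.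
  have : (size visited <= size F)%N; last by rewrite size_map size_iota ltnn.
  apply: le_visited.
  by move=> _ /mapP[i _ ->]; apply/WF/position_in/is_walk_drop.
rewrite size_map size_iota => lt_jF.
have lt_iF := ltn_trans lt_ij lt_jF.
rewrite !(nth_map 0%N) ?size_iota // !nth_iota // !add0n => eq_ij.
pose y := take (j - i) (drop i w).
have def_y : y ++ drop j w = drop i w.
  by rewrite -[in drop j w](subnK (ltnW lt_ij)) -drop_drop cat_take_drop.
have y_w : infix y w by apply: infix_trans (infix_take _ _) (infix_drop _ _).
have [e sz_e] := position_prod y (drop j w); rewrite def_y eq_ij => prod1.
exists y, e; split=> //.
- rewrite -size_eq0 size_take size_drop sz_w; case: ifP => _; lia.
- exact: aperiodic_infix y_w (squarefree_aperiodic n_gt0 sf_w).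
- move=> z /(mem_infix y_w) /(is_walk_mem walk_w)[v].
  exact: moves_mem.
- by apply: (mulgI (position (drop j w))); rewrite prod1 mulg1.
Qed.

End CellWalk.

(** * Relations with squarefree coefficients in amenable groups *)

Section Packing.
Local Open Scope group_scope.
Variables (G : groupType) (A : seq G).

Definition translates_meet (g h : G) : bool :=
  has (fun a => has (fun b => g * a == h * b) A) A.

Lemma translates_meetP g h :
  reflect (exists a b, [/\ a \in A, b \in A & g * a = h * b]) (translates_meet g h).
Proof.
apply: (iffP hasP) => [[a aA /hasP[b bA /eqP eq_ab]]|[a [b [aA bA eq_ab]]]].
  by exists a, b.
by exists a => //; apply/hasP; exists b => //; apply/eqP.
Qed.

Lemma size_packing (N F : seq G) : uniq A -> uniq N ->
  pairwise (fun x y => ~~ translates_meet x y) N ->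
  {in N & A, forall x a, x * a \in F} -> (size N * size A <= size F)%N.
Proof.
move=> uA uN packN NAF; rewrite -(size_allpairs (fun x a => x * a)).
apply: uniq_leq_size; last by move=> _ /allpairsP[[x a] [/= xN aA ->]]; apply: NAF.
elim: N uN packN {NAF} => //= x N IHN /andP[_ uN] /andP[/allP x_N packN].
rewrite cat_uniq map_inj_uniq; last exact: mulgI.
rewrite uA IHN // andbT; apply/hasPn => _ /allpairsP[[y b] [/= yN bA ->]].
apply/mapP => -[a aA eq_ab]; have /negP[] := x_N y yN.
by apply/translates_meetP; exists a, b.
Qed.

End Packing.

(** The relation is read along a walk inside a finite set [F] that is almost
    invariant under [A] and [xi]. For a maximal family [N] of points whose
    translates [x A] are disjoint, there are at most [#F / 16] cells and more
    than [#F / 2] edges from [g] to [g xi], so [8 * #cells < #edges] and there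
    is a core of cells of degree at least 9. A point carries at most two edges,
    so a cell of the core has at least 5 exits, of which at least 4 differ from
    the current point. *)
Lemma amenable_relation (R : realType) (G : groupType) (A : seq G) (xi : G) n :
  amenable R G -> uniq A -> (16 <= size A)%N -> (0 < n)%N ->
  exists (x : seq G) (e : seq bool),
    [/\ x != [::], size e = size x, aperiodic n x,
      {in x, forall y, y != 1%g /\ exists a b c d,
        [/\ a \in A, b \in A, c \in A, d \in A & y = (a / b * (c / d))%g]} &
      (\prod_(i < size x) (signed_power xi (nth false e i) * nth 1 x i) = 1)%g].
Proof.
move=> amG uA leA n_gt0.
have [F [uF small]] := folner_interior (xi :: A) 4 amG.
pose out g := has (fun a => (g * a)%g \notin F) (xi :: A).
pose F0 := [seq g <- F | ~~ out g].
have uF0 : uniq F0 by rewrite filter_uniq.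
have F0xi g : g \in F0 -> (g * xi)%g \in F.
  by rewrite mem_filter => /andP[/hasPn/(_ xi)]; rewrite mem_head negbK => ->.
have F0A g a : g \in F0 -> a \in A -> (g * a)%g \in F.
  rewrite mem_filter => /andP[/hasPn g_in _] aA.
  by have := g_in a; rewrite inE aA orbT negbK => ->.
have meet_refl : reflexive (translates_meet A).
  have [a aA] : exists a, a \in A.
    by case: (A) leA => // a A' _; exists a; rewrite mem_head.
  by move=> g; apply/translates_meetP; exists a, a.
have [N [uN NF0 packN coverN]] := maximal_independent uF0 meet_refl.
(* By maximality of [N], the translate of every interior point meets that of a
   centre; [cell] chooses such a centre. *)
pose cell g := nth 1%g N (find (translates_meet A g) N).
have cellN : {in F0, forall g, cell g \in N}.
  by move=> g /coverN; rewrite has_find => lt; apply: mem_nth.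
have cell_meet : {in F0, forall g, translates_meet A g (cell g)}.
  by move=> g /coverN; apply: nth_find.
have sizeN : (size N * size A <= size F)%N.
  by apply: size_packing => // x a /NF0; apply: F0A.
pose E := [seq g <- F0 | (g * xi)%g \in F0].
have sizeF0 : (count out F + size F0 = size F)%N.
  by rewrite size_filter count_predC.
(* An edge is missing at an interior point only if [g xi] is in [F] but not
   interior. *)
have sizeE : (size F0 <= count out F + size E)%N.
  rewrite -(count_predC (fun g => (g * xi)%g \in F0) F0) -size_filter addnC leq_add2r.
  rewrite -!size_filter -(size_map (fun g => g * xi)%g); apply: uniq_leq_size.
    by rewrite map_inj_uniq ?filter_uniq //; apply: mulIg.
  move=> h /mapP[g]; rewrite mem_filter => /andP[/= gxi gF0] ->.
  by move: gxi; rewrite !mem_filter F0xi // andbT negbK => ->.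
have dense : (8 * size N < size E)%N.
  have : (16 * size N <= size F)%N.
    by apply: leq_trans sizeN; rewrite mulnC leq_mul2l leA orbT.
  by move: small; rewrite -/out; lia.
have [|J [J0 coreJ]] := @dense_core _ _ cell (fun g => cell (g * xi)%g) _ _ _ _ dense.
  by move=> g; rewrite mem_filter => /andP[/cellN -> /cellN ->].
pose W : pred G := fun g => (g \in F0) && (cell g \in J).
have [start W_start] : exists g, W g.
  have [i iJ] : exists i, i \in J.
    by case: (J) J0 => // i J' _; exists i; rewrite mem_head.
  have := coreJ i iJ => /(leq_ltn_trans (leq0n _)).
  rewrite -has_count => /hasP[g]; rewrite mem_filter => /andP[_ gF0].
  by case/and3P=> cJ _ _; exists g; rewrite /W gF0.
have deg u : W u -> (5 <= count (exits xi W cell u) F0)%N.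
  move=> /andP[uF0' cJ]; have := coreJ _ cJ.
  set c := (X in (_ < X)%N) => lt_c.
  suff : (c <= count (exits xi W cell u) F0 + count (exits xi W cell u) F0)%N by lia.
  (* Every edge at the cell of [u] yields an exit: its source or its target,
     whichever lies in this cell. *)
  pose out_edge g := [&& g \in F0, (g * xi)%g \in F0, cell g \in J,
    cell (g * xi)%g \in J & cell g == cell u].
  pose in_edge g := [&& g \in F0, (g * xi)%g \in F0, cell g \in J,
    cell (g * xi)%g \in J & cell (g * xi)%g == cell u].
  apply: (@leq_trans (count out_edge E + count in_edge E)).
    rewrite -count_predUI; apply: leq_trans (leq_addr _ _).
    rewrite leq_eqVlt; apply/orP; left; apply/eqP; apply: eq_in_count => g.
    rewrite mem_filter => /andP[gxi gF0] /=.
    rewrite /out_edge /in_edge gxi gF0 /=.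
    by rewrite -!andb_orr.
  apply: leq_add; rewrite -!size_filter.
    apply: uniq_leq_size; first by rewrite !filter_uniq.
    move=> g; rewrite mem_filter => /andP[/and5P[gF0 gxi cg cgxi eqc] _].
    by rewrite mem_filter gF0 andbT /exits eqc /W gxi cgxi.
  rewrite -(size_map (fun g => g * xi)%g).
  apply: uniq_leq_size.
    by rewrite map_inj_uniq ?filter_uniq //; apply: mulIg.
  move=> h /mapP[g]; rewrite mem_filter => /andP[/and5P[gF0 gxi cg cgxi eqc] _] ->.
  by rewrite mem_filter gxi andbT /exits eqc mulgK /W gF0 cg orbT.
have WF : {subset W <= F}.
  by move=> g /andP[]; rewrite mem_filter => /andP[].
have [x [e [x0 sz_e ap_x x_in prod1]]] :=
  squarefree_relation W_start n_gt0 uF0 WF deg.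
exists x, e; split=> // y /x_in[y1 [u [v [/andP[uF0' _] vF0 eq_c def_y]]]].
split=> //; rewrite {}def_y {y1}.
have /translates_meetP[a [b [aA bA eq_u]]] := cell_meet u uF0'.
have /translates_meetP[a' [b' [a'A b'A eq_v]]] := cell_meet v vF0.
(* Both [u A] and [v A] meet the translate of the common centre [cell u]. *)
exists a', b', b, a; split=> //.
have -> : u = (cell u * b / a)%g by rewrite -eq_u mulgK.
have -> : v = (cell u * b' / a')%g by rewrite -eq_c -eq_v mulgK.
by rewrite !invgM invgK !mulgA mulgVK.
Qed.

(** * Word length *)

Section WordLength.
Local Open Scope group_scope.
Variables (K : groupType) (S : {fset K}).

Lemma is_word_of_lengthP k g :
  reflect (exists s : seq K, [/\ size s = k, {subset s <= letters S} &
             \prod_(x <- s) x = g])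
          (is_word_of_length S k g).
Proof.
apply: (iffP existsP) => [[w /eqP prod_w]|[s [sz_s s_let prod_s]]].
  exists (map val w); rewrite size_map size_tuple big_map; split=> //.
  by move=> _ /mapP[x _ ->]; apply: valP.
have [w def_s] : exists w : seq (letters S), map val w = s.
  elim: s s_let {sz_s prod_s} => [|x s IHs] s_let; first by exists [::].
  have [|w def_s] := IHs; first by move=> y ys; rewrite s_let // inE ys orbT.
  by exists ([` s_let x (mem_head _ _)]%fset :: w); rewrite /= def_s.
have sz_w : size w == k by rewrite -sz_s -def_s size_map.
by exists (Tuple sz_w); rewrite /= -prod_s -def_s big_map.
Qed.

Lemma letters_inv x : x \in letters S -> x^-1 \in letters S.
Proof.
rewrite !in_fsetU => /orP[xS|/imfsetP[y yS ->]]; last by rewrite invgK yS.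
by apply/orP; right; apply: in_imfset.
Qed.

Variable genS : generates S.
Local Notation "''l' g" := (word_length genS g) (at level 10, g at level 8).

Lemma word_length_prod (s : seq K) : {subset s <= letters S} ->
  'l (\prod_(x <- s) x) <= size s.
Proof.
move=> s_let; rewrite /word_length; case: ex_minnP => m _; apply.
by apply/is_word_of_lengthP; exists s.
Qed.

Lemma geodesic g : exists s : seq K,
  [/\ size s = 'l g, {subset s <= letters S} & \prod_(x <- s) x = g].
Proof.
by apply/is_word_of_lengthP; rewrite /word_length; case: ex_minnP.
Qed.

Lemma word_length1 : 'l 1 = 0.
Proof.
by apply/eqP; rewrite -leqn0; have := @word_length_prod [::]; rewrite big_nil; apply.
Qed.

Lemma word_lengthM g h : 'l (g * h) <= 'l g + 'l h.
Proof.
have [s [<- s_let <-]] := geodesic g; have [t [<- t_let <-]] := geodesic h.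
rewrite -big_cat -size_cat; apply: word_length_prod => x.
by rewrite mem_cat => /orP[/s_let|/t_let].
Qed.

Lemma word_lengthV g : 'l (g^-1) <= 'l g.
Proof.
have [s [<- s_let <-]] := geodesic g.
have -> : (\prod_(x <- s) x)^-1 = \prod_(x <- rev [seq x^-1 | x <- s]) x.
  elim: s {s_let} => [|x s IHs]; first by rewrite !big_nil invg1.
  by rewrite /= rev_cons -cats1 big_cat big_seq1 big_cons invgM IHs.
rewrite -(size_map (fun x => x^-1) s) -size_rev; apply: word_length_prod => y.
by rewrite mem_rev => /mapP[x /s_let xl ->]; apply: letters_inv.
Qed.

Lemma word_length_pred n g : 'l g = n.+1 -> exists h, 'l h = n.
Proof.
move=> lg; have [s [sz_s s_let prod_s]] := geodesic g.
case: s sz_s s_let prod_s => [|x s]; rewrite lg // => -[sz_s] s_let.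
rewrite big_cons => prod_s.
have s_let' : {subset s <= letters S}.
  by move=> y ys; rewrite s_let // inE ys orbT.
have x_let : {subset [:: x] <= letters S}.
  by move=> y; rewrite inE => /eqP->; rewrite s_let // mem_head.
exists (\prod_(y <- s) y).
have := word_length_prod s_let'; have := word_length_prod x_let.
have := word_lengthM x (\prod_(y <- s) y).
by rewrite prod_s lg big_seq1 /=; lia.
Qed.

(** The prefixes of a geodesic have all intermediate lengths; this gives many
    distinct elements in a small ball. *)
Lemma spread_lengths n g : n <= 'l g ->
  exists s : seq K, map (word_length genS) s = rev (iota 0 n.+1).
Proof.
move=> le_n; have [h lh] : exists h, 'l h = n.
  move: le_n; move def_m : ('l g) => m; elim: m g def_m => [|m IHm] g lg.
    by rewrite leqn0 => /eqP->; exists g.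
  rewrite leq_eqVlt => /predU1P[->|lt_n]; first by exists g.
  by have [h lh] := word_length_pred lg; apply: (IHm h).
elim: n h lh {g le_n} => [|n IHn] h lh; first by exists [:: h]; rewrite /= lh.
have [h' /IHn[s ls]] := word_length_pred lh.
exists (h :: s); by rewrite -[n.+2]addn1 iotaD rev_cat map_cons lh ls.
Qed.

Lemma short_letter : (exists g : K, g != 1) ->
  exists2 x : K, x != 1 & 'l x <= 1.
Proof.
case=> g g1; have [s [_ s_let prod_s]] := geodesic g.
have /hasP[x xs x1] : has (fun x => x != 1) s.
  apply: contraNT g1 => /hasPn s1; rewrite -prod_s big_seq big1 // => x xs.
  by apply/eqP; rewrite -[_ == _]negbK s1.
exists x => //; have := @word_length_prod [:: x]; rewrite big_seq1; apply.
by move=> y; rewrite inE => /eqP->; apply: s_let.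
Qed.

End WordLength.

(** * Non-amenability *)

Theorem proposition9 (R : realType) (K : groupType) (S : {fset K})
    (genS : generates S) (ntK : exists g : K, g != 1%g)
    (hP : property_P' genS 10 (192%:R : R)%R) :
  ~ amenable R K.
Proof.
move=> amK; have [xi far] := hP.
pose len := word_length genS.
have [x0 x0_1 x0_le1] := short_letter genS ntK.
(* The ball of radius 192 is not all of [K]: the property with [k = 1] says so. *)
have [g len_g] : exists g, 48 <= len g.
  exists (xi * x0)%g.
  have := far 1 [tuple x0] [tuple false] isT
    (squarefree_aperiodic (ltn0Sn 9) (erefl : squarefree [:: x0])).
  rewrite big_ord1 ltr_nat !(tnth_nth 1%g) => lt_len.
  apply: leq_trans (lt_len _ _) => // i; rewrite ord1 (tnth_nth 1%g) //=.
  by rewrite ler_nat; apply: leq_trans x0_le1 _.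
(* The letters of the relation below are products of four elements of [A] or
   their inverses, and 48 = 192 / 4. *)
have [A lenA] := spread_lengths len_g.
have uA : uniq A by apply: (@map_uniq _ _ len); rewrite lenA rev_uniq iota_uniq.
have szA : size A = 49 by rewrite -(size_map len) lenA size_rev size_iota.
have shortA : {in A, forall a, len a <= 48}.
  by move=> a /(map_f len); rewrite lenA mem_rev mem_iota.
have [||x [e [x_n0 sz_e ap_x x_in prod1]]] :=
  @amenable_relation R K A xi 10 amK uA; rewrite ?szA //.
have sz_e' : size e == size x by apply/eqP.
have := far (size x) (in_tuple x) (Tuple sz_e') _ ap_x.
have -> : (\prod_(i < size x) (signed_power xi (tnth (Tuple sz_e') i) *
    tnth (in_tuple x) i) = 1)%g.
  rewrite -[RHS]prod1; apply: eq_bigr => i _.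
  by rewrite (tnth_nth false) (tnth_nth 1%g).
rewrite word_length1 ltr_nat => absurd.
suff : 192 < 0 by []; apply: absurd; first by rewrite lt0n size_eq0.
  by move=> i; have [] := x_in _ (mem_tnth i (in_tuple x)).
move=> i; have [_ [a [b [c [d [aA bA cA dA ->]]]]]] :=
  x_in _ (mem_tnth i (in_tuple x)).
rewrite ler_nat; apply: leq_trans (word_lengthM _ _ _) _.
have le_div u v : u \in A -> v \in A -> len (u / v)%g <= 96.
  move=> uA' vA; apply: leq_trans (word_lengthM _ _ _) _.
  have := word_lengthV genS v; have := shortA u uA'; have := shortA v vA.
  by rewrite /len; lia.
by have := le_div a b aA bA; have := le_div c d cA dA; rewrite /len; lia.
Qed.
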